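(* Let $A \in \mathbb{R}^{m \times n}$, $B \in \mathbb{R}^{m \times p}$, $C \in \mathbb{R}^{s \times n}$, $D\in \mathbb{R}^{s \times p}$ and $M=\begin{pmatrix} A & B \\ C & D \end{pmatrix}$. Put $F=D-CA^\dagger B$ and $G=A-BD^\dagger C$. Suppose that $R(C^T)\subseteq R(A^T)$, $R(B)\subseteq R(A)$, $R((A^\dagger B)^T)\subseteq R(F^T)$, $R(CA^\dagger)\subseteq R(F)$, $R(C)\subseteq R(D)$, $R(B^T)\subseteq R(D^T)$, $R(BD^\dagger)\subseteq R(G)$ and $R((D^\dagger C)^T)\subseteq R(G^T)$. Then $$M^\dagger=\begin{pmatrix} G^\dagger & -A^\dagger BF^\dagger\\ -D^\dagger CG^\dagger & F^\dagger\end{pmatrix}.$$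
   Context: All matrices are real. $R(X)$ denotes the range (column space) of a matrix $X$ and $X^T$ its transpose. For $X\in\mathbb{R}^{m\times n}$, the Moore-Penrose inverse $X^\dagger\in\mathbb{R}^{n\times m}$ is the unique matrix $Y$ satisfying $X=XYX$, $Y=YXY$, $(XY)^T=XY$ and $(YX)^T=YX$. *)

(* Defs.v *)
From HB Require Import structures.
From mathcomp Require Import all_boot all_order all_algebra.
From mathcomp Require Import classical_sets reals.

Set Implicit Arguments.
Unset Strict Implicit.
Unset Printing Implicit Defensive.

Import Order.TTheory GRing.Theory Num.Theory.
Local Open Scope classical_set_scope.
Local Open Scope ring_scope.

(* Column space, as a set of column vectors (the subspace order %MS of
   MathComp is about row spaces). *)
Definition colrange (R : realType) (m n : nat) (X : 'M[R]_(m, n)) :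
    set 'cV[R]_m :=
  range (fun v : 'cV[R]_n => X *m v).

Definition is_mpinv (R : realType) (m n : nat) (X : 'M[R]_(m, n)) :
    pred 'M[R]_(n, m) :=
  fun Y => [&& X == X *m Y *m X, Y == Y *m X *m Y,
               (X *m Y)^T == X *m Y & (Y *m X)^T == Y *m X].

Lemma gram_unitmx (R : realType) (r n : nat) (V : 'M[R]_(r, n)) :
  row_free V -> V *m V^T \in unitmx.
Proof.
move=> Vfree; rewrite -row_free_unit -kermx_eq0; apply/rowV0P => w /sub_kermxP.
move=> wVV0; have : (w *m V) *m (w *m V)^T = 0.
  by rewrite trmx_mul mulmxA -(mulmxA w) wVV0 mul0mx.
move/matrixP/(_ 0 0); rewrite [LHS]mxE [RHS]mxE => /eqP.
rewrite psumr_eq0 => [/allP wV0|j _]; last by rewrite [_^T _ _]mxE -expr2 sqr_ge0.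
have {}wV0 : w *m V = 0.
  apply/rowP => j; have /implyP/(_ isT) := wV0 j (mem_index_enum j).
  by rewrite [_^T _ _]mxE mulf_eq0 orbb => /eqP ->; rewrite mxE.
by apply: (row_free_inj Vfree); rewrite wV0 mul0mx.
Qed.

Lemma mpinv_exists (R : realType) (m n : nat) (X : 'M[R]_(m, n)) :
  exists Y, is_mpinv X Y.
Proof.
have [r [U [V [XE UU VV]]]] : exists r (U : 'M[R]_(m, r)) (V : 'M[R]_(r, n)),
    [/\ X = U *m V, U^T *m U \in unitmx & V *m V^T \in unitmx].
  exists (\rank X), (col_base X), (row_base X).
  split; first by rewrite mulmx_base.
  - rewrite -{2}[col_base X]trmxK; apply: gram_unitmx.
    by rewrite /row_free mxrank_tr; exact: col_base_full.
  - by apply: gram_unitmx; exact: row_base_free.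
pose P := invmx (U^T *m U); pose Q := invmx (V *m V^T).
have PT : P^T = P by rewrite /P trmx_inv trmx_mul trmxK.
have QT : Q^T = Q by rewrite /Q trmx_inv trmx_mul trmxK.
exists (V^T *m Q *m P *m U^T).
have XY : X *m (V^T *m Q *m P *m U^T) = U *m P *m U^T.
  by rewrite XE !mulmxA -(mulmxA U) -(mulmxA U (V *m V^T)) mulmxV // mulmx1.
have YX : V^T *m Q *m P *m U^T *m X = V^T *m Q *m V.
  rewrite XE !mulmxA -(mulmxA _ U^T U) -(mulmxA _ P (U^T *m U)).
  by rewrite mulVmx // mulmx1.
apply/and4P; split; apply/eqP; rewrite ?XY ?YX.
- by rewrite XE !mulmxA -(mulmxA _ U^T U) -(mulmxA _ P (U^T *m U)) mulVmx // mulmx1.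
- by rewrite !mulmxA -(mulmxA _ V V^T) -(mulmxA _ Q (V *m V^T)) mulVmx // mulmx1.
- by rewrite !trmx_mul trmxK PT mulmxA.
- by rewrite !trmx_mul trmxK QT mulmxA.
Qed.

(* The choice made by xchoose is immaterial, see mpinv_unique. *)
Definition mpinv (R : realType) (m n : nat) (X : 'M[R]_(m, n)) :
    'M[R]_(n, m) :=
  xchoose (mpinv_exists X).

Lemma mpinvP (R : realType) (m n : nat) (X : 'M[R]_(m, n)) :
  is_mpinv X (mpinv X).
Proof. exact: xchooseP. Qed.

Lemma mpinv_unique (R : realType) (m n : nat) (X : 'M[R]_(m, n))
    (Y : 'M[R]_(n, m)) : is_mpinv X Y -> Y = mpinv X.
Proof.
move: (mpinv X) (mpinvP X) => Z.
case/and4P => /eqP XZX /eqP ZXZ /eqP XZ /eqP ZX.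
case/and4P => /eqP XYX /eqP YXY /eqP XY /eqP YX.
have XYZ : X *m Y = X *m Z.
  by rewrite -XY {1}XZX -(mulmxA (X *m Z)) trmx_mul XY XZ !mulmxA -XYX.
have YXZ : Y *m X = Z *m X.
  by rewrite -YX {1}XZX !mulmxA -(mulmxA (Y *m X)) trmx_mul YX ZX -mulmxA (mulmxA X) -XYX.
by rewrite YXY YXZ -mulmxA XYZ mulmxA -ZXZ.
Qed.

(* Main.v *)
Require Import Defs.
From HB Require Import structures.
From mathcomp Require Import all_boot all_order all_algebra.
From mathcomp Require Import classical_sets reals.

Set Implicit Arguments.
Unset Strict Implicit.
Unset Printing Implicit Defensive.

Import Order.TTheory GRing.Theory Num.Theory.
Local Open Scope classical_set_scope.
Local Open Scope ring_scope.

(** Write X^+ for [mpinv X], and N for the proposed inverse of M.  The range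
    hypotheses say exactly that certain orthogonal projections X X^+ and X^+ X
    act as identities ([colrange_mpinvK], [rowrange_mpinvK]).  They give two
    facts, each of which also holds with the roles of (A, B, G) and (D, C, F)
    exchanged:

    - G has the same column space and the same row space as A, hence
      G G^+ = A A^+ and G^+ G = A^+ A ([schur_colproj], [schur_rowproj]);
    - the Woodbury formula G^+ = A^+ + A^+ B F^+ C A^+ survives for
      Moore-Penrose inverses ([woodbury_mpinv]).

    The product M N collapses to diag (G G^+, F F^+) from the definitions of F
    and G alone, while N M collapses to diag (G^+ G, F^+ F) by Woodbury
    ([schur_mpinv_row]).  Both are symmetric, and since these projections fix
    the blocks of M and of N, the four Penrose equations hold. *)

(** * Moore-Penrose projections and ranges *)

Lemma mpinvK (R : realType) (m n : nat) (X : 'M[R]_(m, n)) :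
  X *m mpinv X *m X = X.
Proof. by case/and4P: (mpinvP X) => /eqP <-. Qed.

Lemma mpinvVK (R : realType) (m n : nat) (X : 'M[R]_(m, n)) :
  mpinv X *m X *m mpinv X = mpinv X.
Proof. by case/and4P: (mpinvP X) => _ /eqP <-. Qed.

Lemma trmx_colproj (R : realType) (m n : nat) (X : 'M[R]_(m, n)) :
  (X *m mpinv X)^T = X *m mpinv X.
Proof. by case/and4P: (mpinvP X) => _ _ /eqP. Qed.

Lemma trmx_rowproj (R : realType) (m n : nat) (X : 'M[R]_(m, n)) :
  (mpinv X *m X)^T = mpinv X *m X.
Proof. by case/and4P: (mpinvP X) => _ _ _ /eqP. Qed.

Lemma colrange_factor (R : realType) (m n p : nat)
    (X : 'M[R]_(m, n)) (Y : 'M[R]_(m, p)) :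
  colrange X `<=` colrange Y -> exists Z, X = Y *m Z.
Proof.
move=> sXY.
have colX j : exists v : 'cV[R]_p, Y *m v == col j X.
  have /sXY [v _ Yv] : colrange X (col j X) by exists (delta_mx j 0); rewrite ?colE.
  by exists v; apply/eqP.
exists (\matrix_(i, j) xchoose (colX j) i 0).
apply/matrixP => i j; have /eqP/matrixP/(_ i 0) := xchooseP (colX j).
by rewrite !mxE => <-; apply: eq_bigr => k _; rewrite mxE.
Qed.

Lemma colrange_mpinvK (R : realType) (m n p : nat)
    (X : 'M[R]_(m, n)) (Y : 'M[R]_(m, p)) :
  colrange X `<=` colrange Y -> Y *m mpinv Y *m X = X.
Proof. by case/colrange_factor => Z ->; rewrite mulmxA mpinvK. Qed.

Lemma rowrange_mpinvK (R : realType) (m n p : nat)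
    (X : 'M[R]_(m, n)) (Y : 'M[R]_(p, n)) :
  colrange X^T `<=` colrange Y^T -> X *m mpinv Y *m Y = X.
Proof.
case/colrange_factor => Z /(congr1 trmx); rewrite trmx_mul !trmxK => ->.
by rewrite -!mulmxA (mulmxA Y) mpinvK.
Qed.

(** Each projection absorbs the other on one side; transposing moves the
    absorption to the other side, so the two coincide. *)
Lemma eq_colproj (R : realType) (m n p : nat)
    (X : 'M[R]_(m, n)) (Y : 'M[R]_(m, p)) :
  X *m mpinv X *m Y = Y -> Y *m mpinv Y *m X = X ->
  X *m mpinv X = Y *m mpinv Y.
Proof.
move=> XY YX; rewrite -trmx_colproj -{1}YX -(mulmxA _ X) trmx_mul.
by rewrite !trmx_colproj mulmxA XY.
Qed.

Lemma eq_rowproj (R : realType) (m n p : nat)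
    (X : 'M[R]_(m, n)) (Y : 'M[R]_(p, n)) :
  Y *m mpinv X *m X = Y -> X *m mpinv Y *m Y = X ->
  mpinv X *m X = mpinv Y *m Y.
Proof.
move=> XY YX; rewrite -trmx_rowproj -{2}YX -(mulmxA X) (mulmxA (mpinv X)).
by rewrite trmx_mul !trmx_rowproj -!mulmxA (mulmxA Y) XY.
Qed.

(** * Generalized Schur complements *)

(** Since G and A differ by B D^+ C, whose columns lie in both column spaces,
    these spaces agree. *)
Lemma schur_colproj (R : realType) (m n p s : nat)
    (A : 'M[R]_(m, n)) (B : 'M[R]_(m, p)) (C : 'M[R]_(s, n)) (D : 'M[R]_(s, p))
    (G := A - B *m mpinv D *m C) :
  A *m mpinv A *m B = B -> G *m mpinv G *m (B *m mpinv D) = B *m mpinv D ->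
  G *m mpinv G = A *m mpinv A.
Proof.
move=> AB GB; apply: eq_colproj; last first.
  by rewrite {1}/G mulmxBr mpinvK !mulmxA AB.
have {1}-> : A = G + B *m mpinv D *m C by rewrite subrK.
by rewrite mulmxDr mpinvK mulmxA GB subrK.
Qed.

Lemma schur_rowproj (R : realType) (m n p s : nat)
    (A : 'M[R]_(m, n)) (B : 'M[R]_(m, p)) (C : 'M[R]_(s, n)) (D : 'M[R]_(s, p))
    (G := A - B *m mpinv D *m C) :
  C *m mpinv A *m A = C -> mpinv D *m C *m mpinv G *m G = mpinv D *m C ->
  mpinv G *m G = mpinv A *m A.
Proof.
move=> CA CG; apply: eq_rowproj; last first.
  by rewrite {1}/G !mulmxBl mpinvK -!mulmxA (mulmxA C) CA mulmxA.
have AE : A = G + B *m (mpinv D *m C) by rewrite mulmxA subrK.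
clearbody G; rewrite {1}AE !mulmxDl mpinvK.
by rewrite -!(mulmxA B) CG -AE.
Qed.

(** Call W the right-hand side of the conclusion.  Substituting
    C A^+ B = D - F telescopes G W to A A^+ = G G^+, so W and G^+ agree after
    multiplication by G; both have their columns in the row space of G, on
    which G is injective. *)
Lemma woodbury_mpinv (R : realType) (m n p s : nat)
    (A : 'M[R]_(m, n)) (B : 'M[R]_(m, p)) (C : 'M[R]_(s, n)) (D : 'M[R]_(s, p))
    (F := D - C *m mpinv A *m B) (G := A - B *m mpinv D *m C) :
  A *m mpinv A *m B = B -> B *m mpinv D *m D = B ->
  F *m mpinv F *m (C *m mpinv A) = C *m mpinv A ->
  G *m mpinv G = A *m mpinv A -> mpinv G *m G = mpinv A *m A ->
  mpinv G = mpinv A + mpinv A *m B *m mpinv F *m C *m mpinv A.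
Proof.
move=> AB BD FC GG GG'; set W := (RHS).
have CAB : C *m mpinv A *m B = D - F by rewrite /F opprB addrC subrK.
have GW : G *m W = A *m mpinv A.
  have AW : A *m W = A *m mpinv A + B *m mpinv F *m C *m mpinv A.
    by rewrite mulmxDr !mulmxA AB.
  have BW : B *m mpinv D *m C *m W = B *m mpinv F *m C *m mpinv A.
    have -> : B *m mpinv D *m C *m W = B *m mpinv D *m (C *m mpinv A)
        + B *m mpinv D *m (C *m mpinv A *m B) *m mpinv F *m (C *m mpinv A).
      by rewrite mulmxDr !mulmxA.
    rewrite CAB mulmxBr BD !mulmxBl.
    by rewrite -(mulmxA _ F) -(mulmxA _ (F *m _)) FC addrC subrK mulmxA.
  by rewrite mulmxBl AW BW addrK.
have -> : W = mpinv G *m G *m W by rewrite GG' mulmxDr !mulmxA mpinvVK.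
by rewrite -mulmxA GW -GG mulmxA mpinvVK.
Qed.

(** The first block row of N M; the second one is the same statement with
    (A, B, G) and (D, C, F) exchanged. *)
Lemma schur_mpinv_row (R : realType) (m n p s : nat)
    (A : 'M[R]_(m, n)) (B : 'M[R]_(m, p)) (C : 'M[R]_(s, n)) (D : 'M[R]_(s, p))
    (F := D - C *m mpinv A *m B) (G := A - B *m mpinv D *m C) :
  C *m mpinv A *m A = C -> mpinv A *m B *m mpinv F *m F = mpinv A *m B ->
  mpinv G = mpinv A + mpinv A *m B *m mpinv F *m C *m mpinv A ->
  mpinv G *m A = mpinv A *m A + mpinv A *m B *m mpinv F *m C /\
  mpinv G *m B = mpinv A *m B *m mpinv F *m D.
Proof.
move=> CA BF ->; split; rewrite mulmxDl.
  by rewrite -!mulmxA (mulmxA C) CA.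
have -> : D = F + C *m mpinv A *m B by rewrite subrK.
by rewrite [RHS]mulmxDr BF !mulmxA.
Qed.

(** * The block formula *)

Theorem theorem1p4 (R : realType) (m n p s : nat)
    (A : 'M[R]_(m, n)) (B : 'M[R]_(m, p))
    (C : 'M[R]_(s, n)) (D : 'M[R]_(s, p)) :
  let M := block_mx A B C D in
  let F := D - C *m mpinv A *m B in
  let G := A - B *m mpinv D *m C in
  colrange C^T `<=` colrange A^T ->
  colrange B `<=` colrange A ->
  colrange (mpinv A *m B)^T `<=` colrange F^T ->
  colrange (C *m mpinv A) `<=` colrange F ->
  colrange C `<=` colrange D ->
  colrange B^T `<=` colrange D^T ->
  colrange (B *m mpinv D) `<=` colrange G ->
  colrange (mpinv D *m C)^T `<=` colrange G^T ->
  mpinv M = block_mx (mpinv G) (- (mpinv A *m B *m mpinv F))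
                     (- (mpinv D *m C *m mpinv G)) (mpinv F).
Proof.
move=> M F G.
move=> /rowrange_mpinvK CA /colrange_mpinvK AB /rowrange_mpinvK BF.
move=> /colrange_mpinvK FC /colrange_mpinvK DC /rowrange_mpinvK BD.
move=> /colrange_mpinvK GB /rowrange_mpinvK CG.
have GG := schur_colproj AB GB; have GG' := schur_rowproj CA CG.
have FF := schur_colproj DC FC; have FF' := schur_rowproj BD BF.
have [GA GB'] := schur_mpinv_row CA BF (woodbury_mpinv AB BD FC GG GG').
have [FD FC'] := schur_mpinv_row BD CG (woodbury_mpinv DC CA GB FF FF').
rewrite -/F -/G in GG GG' FF FF' GA GB' FD FC' *.
set N := block_mx _ _ _ _.
have MN : M *m N = block_mx (G *m mpinv G) 0 0 (F *m mpinv F).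
  rewrite mulmx_block !mulmxN !mulmxA AB DC addNr subrr.
  by rewrite [- _ + _ *m mpinv F]addrC -!mulmxBl.
have NM : N *m M = block_mx (mpinv G *m G) 0 0 (mpinv F *m F).
  rewrite mulmx_block !mulNmx GA GB' FC' FD GG' FF'.
  by rewrite addrK subrr addNr addrC addrK.
apply/esym/mpinv_unique/and4P; split; apply/eqP.
- rewrite MN mulmx_block !mul0mx !addr0 !add0r.
  by rewrite GG FF AB DC !mpinvK.
- rewrite NM mulmx_block !mul0mx !addr0 !add0r !mulmxN !mulmxA !mpinvVK.
  by rewrite GG' FF' !mpinvVK.
- by rewrite MN tr_block_mx !trmx0 !trmx_colproj.
- by rewrite NM tr_block_mx !trmx0 !trmx_rowproj.
Qed.
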